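(* We have: (a) $\mathfrak{g}_{\mathrm{DSO}}(2)=0$, (b) $\mathfrak{g}_{\mathrm{DSO}}(3)=0$, (c) $\mathfrak{g}_{\mathrm{ODJM}}(2)=0$, (d) $\mathfrak{g}_{\mathrm{ODJM}}(3)=0$. Equivalently, $\mathfrak{g}_{\mathrm{DSO}}(v)=0$ for any irreducible $v$ in $\mathbb{R}^2$ or $\mathbb{R}^3$, and $\mathfrak{g}_{\mathrm{ODJM}}(a)=0$ for any irreducible $a$ in $\mathbb{R}_+^2$ or $\mathbb{R}_+^3$.
   Context: Write $\mathbb{R}_+ = (0,\infty)$. For $a \in \mathbb{R}_+^p$ and $v \in \mathbb{R}^p$ (with $p\ge 2$), let $J_{a,v}(\theta)$, $\theta \in \mathbb{R}$, be the Hermitian $p\times p$ matrix with diagonal entries $v_1,\dots,v_p$, entries $a_1,\dots,a_{p-1}$ on the first super- and sub-diagonals (i.e. the $(j,j+1)$ and $(j+1,j)$ entries equal $a_j$ for $1\le j\le p-1$), $(1,p)$ entry $e^{-2\pi i \theta}a_p$, $(p,1)$ entry $e^{2\pi i\theta}a_p$, and all other entries zero; when $p=2$ the contributions to the same entry are added, so the $(1,2)$ entry is $a_1+e^{-2\pi i\theta}a_2$ and the $(2,1)$ entry is $a_1+e^{2\pi i\theta}a_2$. (These are the Floquet matrices of the periodic Jacobi matrix $[\mathbf{J}_{a,v}\psi](n) = A(n-1)\psi(n-1)+V(n)\psi(n)+A(n)\psi(n+1)$ on $\ell^2(\mathbb{Z})$, where $A,V$ are the $p$-periodic extensions of $a,v$.)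 Let $\lambda_1(\theta)\le\cdots\le\lambda_p(\theta)$ be the eigenvalues of $J_{a,v}(\theta)$ counted with multiplicity, and put $\lambda_j^- = \min_{\theta\in[0,1]}\lambda_j(\theta)$, $\lambda_j^+ = \max_{\theta\in[0,1]}\lambda_j(\theta)$. It is known that $\lambda_1^-<\lambda_1^+\le\lambda_2^-<\cdots\le\lambda_p^-<\lambda_p^+$. A number $\lambda\in\mathbb{R}$ is a closed gap of $(a,v)$ if $\lambda=\lambda_j^+=\lambda_{j+1}^-$ for some $1\le j\le p-1$. Let $\mathfrak{g}(a,v)$ be the number of closed gaps of $(a,v)$; put $\mathfrak{g}_{\mathrm{DSO}}(v)=\mathfrak{g}(\mathbf{1},v)$ for $v\in\mathbb{R}^p$, where $\mathbf{1}=(1,\dots,1)$, and $\mathfrak{g}_{\mathrm{ODJM}}(a)=\mathfrak{g}(a,\mathbf{0})$ for $a\in\mathbb{R}_+^p$, where $\mathbf{0}=(0,\dots,0)$. Let $\mathrm{cyc}(v_1,\dots,v_p)=(v_2,\dots,v_p,v_1)$. A vector $v \in \mathbb{R}^p$ is irreducible if $v,\mathrm{cyc}(v),\dots,\mathrm{cyc}^{p-1}(v)$ are pairwise distinct, and reducible otherwise. Define $\mathfrak{g}_{\mathrm{DSO}}(p)=\max\{\mathfrak{g}_{\mathrm{DSO}}(v): v\in\mathbb{R}^p \text{ irreducible}\}$ and $\mathfrak{g}_{\mathrm{ODJM}}(p)=\max\{\mathfrak{g}_{\mathrm{ODJM}}(a): a\in\mathbb{R}_+^p\text{ irreducible}\}$.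 *)

(* Defs.v *)
From HB Require Import structures.
From mathcomp Require Import all_boot all_order all_algebra.
From mathcomp Require Import finmap.
From mathcomp Require Import all_classical all_reals all_analysis.
From mathcomp Require Import complex.

Set Implicit Arguments.
Unset Strict Implicit.
Unset Printing Implicit Defensive.

Import Order.TTheory GRing.Theory Num.Theory.

Local Open Scope classical_set_scope.
Local Open Scope complex_scope.
Local Open Scope ring_scope.

Definition is_max {d : Order.disp_t} {T : porderType d} (A : set T) (m : T) : Prop :=
  A m /\ ubound A m.

Definition is_min {d : Order.disp_t} {T : porderType d} (A : set T) (m : T) : Prop :=
  A m /\ lbound A m.

Definition cexpi {R : realType} (t : R) : R[i] := cos t +i* sin t.

(* Indices start at 0, so a_j of the usual 1-based notation is a 0 (j - 1).
   The contributions are added: for p = 2 the corner terms fall on the off-diagonal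
   entries. Only p >= 2 is meaningful. *)
Definition floquet {R : realType} {p : nat} (a v : 'rV[R]_p) (theta : R)
    : 'M[R[i]]_p :=
  \matrix_(j < p, k < p)
    ((v 0 j)%:C *+ (j == k)
     + (a 0 j)%:C *+ (j.+1 == k :> nat)
     + (a 0 k)%:C *+ (k.+1 == j :> nat)
     + cexpi (- (2 * pi * theta)) * (a 0 k)%:C *+ ((j == 0%N :> nat) && (k.+1 == p))
     + cexpi (2 * pi * theta) * (a 0 j)%:C *+ ((k == 0%N :> nat) && (j.+1 == p))).

(* The roots of the characteristic polynomial, repeated according to multiplicity,
   in nondecreasing order. Meant for Hermitian matrices, whose eigenvalues are real,
   so that taking real parts loses nothing. *)
Definition eigenvalues {R : realType} {p : nat} (M : 'M[R[i]]_p) : seq R :=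
  sort <=%R [seq complex.Re z | z <- sval (closed_field_poly_normal (char_poly M))].

(* With 0-based j, this is lambda_(j+1)(theta). *)
Definition band_fun {R : realType} {p : nat} (a v : 'rV[R]_p) (j : nat) (theta : R) : R :=
  (eigenvalues (floquet a v theta))`_j.

Definition band {R : realType} {p : nat} (a v : 'rV[R]_p) (j : nat) : set R :=
  [set band_fun a v j theta | theta in `[0, 1]].

Definition closed_gap {R : realType} {p : nat} (a v : 'rV[R]_p) (lambda : R) : Prop :=
  exists j : nat, [/\ (j.+1 < p)%N,
    is_max (band a v j) lambda & is_min (band a v j.+1) lambda].

Lemma finite_closed_gap {R : realType} {p : nat} (a v : 'rV[R]_p) :
  finite_set [set lambda | closed_gap a v lambda].
Proof.
apply: (@sub_finite_set _ _ ((fun j => xget 0 (is_max (band a v j))) @` `I_p)); last first.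
  exact/finite_image/finite_II.
move=> l [j [jp lmax _]]; exists j; first exact: ltnW.
case: xgetP => [m _ [Am mub]|/(_ l)//].
by case: lmax => Al lub; apply/le_anti; rewrite lub// mub.
Qed.

(* fset_set is meaningful on finite sets only, see finite_closed_gap. *)
Definition num_closed_gaps {R : realType} {p : nat} (a v : 'rV[R]_p) : nat :=
  #|` fset_set [set lambda | closed_gap a v lambda] |%fset.

Definition gDSO {R : realType} {p : nat} (v : 'rV[R]_p) : nat :=
  num_closed_gaps (const_mx 1) v.

Definition gODJM {R : realType} {p : nat} (a : 'rV[R]_p) : nat :=
  num_closed_gaps a 0.

Definition cyc {R : realType} {p : nat} (v : 'rV[R]_p) : 'rV[R]_p :=
  \row_(j < p) v 0 (ordS j).

Definition irreducible_vec {R : realType} {p : nat} (v : 'rV[R]_p) : Prop :=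
  injective (fun k : 'I_p => iter k cyc v).

Definition positive_vec {R : realType} {p : nat} (a : 'rV[R]_p) : Prop :=
  forall j : 'I_p, 0 < a 0 j.

(* The maxima g_DSO(p) and g_ODJM(p) are given by their graphs: the relation
   includes that the maximum is attained. *)
Definition gDSO_max_is (R : realType) (p m : nat) : Prop :=
  is_max [set gDSO v | v in [set v : 'rV[R]_p | irreducible_vec v]] m.

Definition gODJM_max_is (R : realType) (p m : nat) : Prop :=
  is_max [set gODJM a | a in [set a : 'rV[R]_p | positive_vec a /\ irreducible_vec a]] m.

(* Main.v *)
Require Import Defs.
From mathcomp Require Import all_boot all_order all_algebra.
From mathcomp Require Import all_classical all_reals all_analysis.
From mathcomp Require Import finmap complex ring lra.

(** The corner phase of the Floquet matrix J(theta) enters its characteristic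
    polynomial only through the constant term: that polynomial is
    q(X) - 2 A cos(2 pi theta), where q does not depend on theta and A is the
    product of the a_j, hence nonzero. Suppose that l is a closed gap: the j-th
    eigenvalue equals l at some theta0 and the next one equals l at some theta1.
    Then q(l) = 2 A cos(2 pi theta0) = 2 A cos(2 pi theta1), so both angles have
    the same cosine, J(theta0) and J(theta1) have the same spectrum, and l occurs
    at two consecutive places in it. So l is a double root of a characteristic
    polynomial (closed_gap_double_root).

    What remains is real algebra for l - J(theta0), a Hermitian matrix of order 2
    or 3 with a double eigenvalue 0. In order 2 such a matrix vanishes; this forces
    v_1 = v_2 and a_1 = a_2 (closed_gap2). In order 3 its principal 2-minors vanish,
    which gives (l - v_1)(l - v_2) = a_1 ^ 2 and two similar equations
    (closed_gap3). When all a_j are 1, or all v_j are 0, these equations force the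
    remaining vector to be constant, hence reducible. The maxima are over nonempty
    sets, since (1, 2, ..., p) is positive and irreducible. *)

Set Implicit Arguments.
Unset Strict Implicit.
Unset Printing Implicit Defensive.

Import Order.TTheory GRing.Theory Num.Theory.

Local Open Scope classical_set_scope.
Local Open Scope complex_scope.
Local Open Scope ring_scope.

(** * The spectrum of a Hermitian matrix *)

(** In a unitary eigenbasis M becomes a real diagonal matrix, and an eigenvector
    for z has a nonzero coordinate there, so z is one of the diagonal entries. *)
Lemma root_char_poly_hermitian (C : numClosedFieldType) n (M : 'M[C]_n) (z : C) :
  M \is hermsymmx -> root (char_poly M) z -> z \is Num.real.
Proof.
move=> hM; rewrite -eigenvalue_root_char => /eigenvalueP[u uM u0].
have /orthomx_spectralP := hermitian_normalmx hM.
have := hermitian_spectral_diag_real hM.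
move: (spectralmx M) (spectral_unit M) (spectral_diag M) => P Pu d /mxOverP dr ME.
pose w := u *m invmx P.
have wd : w *m diag_mx d = z *: w.
  by rewrite /w scalemxAl -uM ME !mulmxA mulmxK.
have /rV0Pn[i wi] : w != 0.
  apply: contra u0 => /eqP w0.
  by rewrite -[u](mulmxKV Pu) -/w w0 mul0mx.
have : w 0 i * d 0 i = w 0 i * z.
  by have /rowP/(_ i) := wd; rewrite mul_mx_diag !mxE [z * _]mulrC.
by move/(mulfI wi) <-; exact: dr.
Qed.

(** * Spectra of Floquet matrices and closed gaps *)

Section FloquetSpectrum.
Context {R : realType}.

Lemma conj_cexpi (t : R) : (cexpi t)^*%C = cexpi (- t).
Proof. by rewrite /cexpi /= cosN sinN. Qed.

Lemma cexpiMN (t : R) : cexpi t * cexpi (- t) = 1.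
Proof.
rewrite /cexpi cosN sinN; apply/eqP; rewrite eq_complex /=; apply/andP; split.
  by apply/eqP; have := cos2Dsin2 t; rewrite !expr2 => <-; ring.
by apply/eqP; ring.
Qed.

Lemma cexpiDN (t : R) : cexpi t + cexpi (- t) = (2 * cos t)%:C.
Proof.
by rewrite /cexpi cosN sinN; apply/eqP; rewrite eq_complex /=; apply/andP; split;
  apply/eqP; ring.
Qed.

Lemma polyC_cexpiMN (t : R) : (cexpi t)%:P * (cexpi (- t))%:P = 1.
Proof. by rewrite -polyCM cexpiMN. Qed.

Lemma polyC_cexpiDN (t : R) :
  (cexpi t)%:P + (cexpi (- t))%:P = (1%:C%:P + 1%:C%:P) * (cos t)%:C%:P.
Proof. by rewrite -polyCD cexpiDN rmorphM rmorphD /= polyCM polyCD. Qed.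

Lemma floquet_hermitian p (a v : 'rV[R]_p) theta :
  floquet a v theta \is hermsymmx.
Proof.
apply/is_hermitianmxP; rewrite expr0 scale1r; apply/matrixP => j k.
rewrite !mxE -[RHS]/((_ : R[i])^*%C).
have cD (x y : R[i]) : (x + y)^*%C = x^*%C + y^*%C by exact: rmorphD.
have cMn (x : R[i]) n : (x *+ n)^*%C = x^*%C *+ n by exact: rmorphMn.
have cM (x y : R[i]) : (x * y)^*%C = x^*%C * y^*%C by exact: rmorphM.
rewrite !cD !cMn !cM !conjc_real !conj_cexpi opprK.
rewrite (eq_sym k j).
have -> : (v 0 j)%:C *+ (j == k) = (v 0 k)%:C *+ (j == k).
  by case: eqP => [->|].
by ring.
Qed.

(** The list of eigenvalues keeps only real parts of roots; since the roots are
    real, it still determines the characteristic polynomial. *)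
Lemma char_poly_eigenvalues p (M : 'M[R[i]]_p) : M \is hermsymmx ->
  char_poly M = map_poly (real_complex R) (\prod_(x <- eigenvalues M) ('X - x%:P)).
Proof.
move=> hM; rewrite /eigenvalues; case: closed_field_poly_normal => s /= sE.
move: sE; rewrite (monicP (char_poly_monic M)) scale1r => sE.
rewrite (perm_big _ (permEl (perm_sort _ _))) /= big_map rmorph_prod /=.
rewrite [LHS]sE; apply: eq_big_seq => z zs.
rewrite map_polyXsubC /= RRe_real//; apply: (root_char_poly_hermitian hM).
by rewrite sE root_prod_XsubC.
Qed.

Lemma size_eigenvalues p (M : 'M[R[i]]_p) : size (eigenvalues M) = p.
Proof.
rewrite /eigenvalues size_sort size_map; case: closed_field_poly_normal => s /= sE.
have := size_char_poly M.
by rewrite sE (monicP (char_poly_monic M)) scale1r size_prod_XsubC => -[].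
Qed.

Lemma root_deriv_prod_XsubC (s : seq R) j : (j.+1 < size s)%N ->
  s`_j = s`_j.+1 -> root (\prod_(x <- s) ('X - x%:P))^`() s`_j.
Proof.
move=> js sj; have js' := ltnW js.
rewrite -[in X in root X _](cat_take_drop j s) (drop_nth 0 js') (drop_nth 0 js) -sj.
rewrite big_cat !big_cons.
set A := \big[_/_]_(_ <- take _ _) _; set B := \big[_/_]_(_ <- drop _ _) _.
rewrite -[X in X^`()]/(A * (('X - (s`_j)%:P) * (('X - (s`_j)%:P) * B))) /root.
by rewrite !derivM !derivXsubC !(hornerXsubC, hornerM, hornerD) subrr !(mul0r, mulr0, addr0).
Qed.

(** The two ends of a closed gap are attained at angles with the same cosine,
    so with the same list of eigenvalues, and l fills two consecutive places of
    that list. *)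
Lemma closed_gap_double_root p (a v : 'rV[R]_p) (q : {poly R}) (c l : R) :
  c != 0 ->
  (forall theta, char_poly (floquet a v theta) =
    map_poly (real_complex R) (q - (c * cos (2 * pi * theta))%:P)) ->
  closed_gap a v l ->
  exists theta, q.[l] = c * cos (2 * pi * theta) /\ q^`().[l] = 0.
Proof.
move=> c0 qE [j [jp [[t0 _ l0] _] [[t1 _ l1] _]]].
have qprod theta : q - (c * cos (2 * pi * theta))%:P =
    \prod_(x <- eigenvalues (floquet a v theta)) ('X - x%:P).
  apply: (map_poly_inj (real_complex R)).
  by rewrite -qE -char_poly_eigenvalues//; exact: floquet_hermitian.
have ql i theta : (i < p)%N -> band_fun a v i theta = l ->
    q.[l] = c * cos (2 * pi * theta).
  move=> ip il; apply/eqP; rewrite -subr_eq0.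
  have -> : q.[l] - c * cos (2 * pi * theta) = (q - (c * cos (2 * pi * theta))%:P).[l].
    by rewrite !hornerE.
  rewrite qprod -/(root _ _) root_prod_XsubC -il mem_nth// size_eigenvalues.
  exact: ip.
exists t0; split; first exact: (ql j _ (ltnW jp)).
have cosE : cos (2 * pi * t1) = cos (2 * pi * t0).
  by apply: (mulfI c0); rewrite -(ql _ _ jp l1) -(ql _ _ (ltnW jp) l0).
have evE : eigenvalues (floquet a v t1) = eigenvalues (floquet a v t0).
  by rewrite /eigenvalues !qE cosE.
have dE : q^`() = (\prod_(x <- eigenvalues (floquet a v t0)) ('X - x%:P))^`().
  by rewrite -qprod derivB derivC subr0.
rewrite -l0 /band_fun dE; apply/eqP/root_deriv_prod_XsubC.
  by rewrite size_eigenvalues.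
by move: l0 l1; rewrite /band_fun evE => -> ->.
Qed.

(** * Characteristic polynomials in orders 2 and 3 *)

Lemma det2 (A : comNzRingType) (M : 'M[A]_2) :
  \det M = M 0 0 * M 1 1 - M 0 1 * M 1 0.
Proof.
rewrite (expand_det_row _ 0) !big_ord_recl big_ord0 /cofactor !det_mx11 !mxE /=.
rewrite !addr0 expr0 expr1 !mul1r mulN1r mulrN.
by do ![congr (_ + _)|congr (_ * _)|congr (- _)|congr (fun_of_matrix M _ _)];
  apply/val_inj.
Qed.

Lemma det3 (A : comNzRingType) (M : 'M[A]_3) :
  \det M = M 0 0 * (M 1 1 * M 2 2 - M 1 2 * M 2 1)
    - M 0 1 * (M 1 0 * M 2 2 - M 1 2 * M 2 0)
    + M 0 2 * (M 1 0 * M 2 1 - M 1 1 * M 2 0).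
Proof.
rewrite (expand_det_row _ 0) !big_ord_recl big_ord0 /cofactor !det2 !mxE /=.
rewrite -signr_odd /= -[in X in _ + (X + _)]signr_odd -[in X in _ + (_ + X)]signr_odd /=.
rewrite expr0 expr1 addr0 !mul1r mulN1r mulrN addrA.
by do ![congr (_ + _)|congr (_ * _)|congr (- _)|congr (fun_of_matrix M _ _)];
  apply/val_inj.
Qed.

(** Divided by the product of the a_j, this and the next polynomial are the
    discriminant of Floquet theory, that is the trace of the monodromy matrix: it
    takes the value 2 cos(2 pi theta) at the eigenvalues of J(theta). *)
Definition discriminant2 (a v : 'rV[R]_2) : {poly R} :=
  ('X - (v 0 0)%:P) * ('X - (v 0 1)%:P) - (a 0 0 ^+ 2 + a 0 1 ^+ 2)%:P.

Definition discriminant3 (a v : 'rV[R]_3) : {poly R} :=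
  ('X - (v 0 0)%:P) * ('X - (v 0 1)%:P) * ('X - (v 0 2)%:P)
  - (a 0 0 ^+ 2)%:P * ('X - (v 0 2)%:P)
  - (a 0 1 ^+ 2)%:P * ('X - (v 0 0)%:P)
  - (a 0 2 ^+ 2)%:P * ('X - (v 0 1)%:P).

(** The phase survives only through the trace
    cexpi t + cexpi (- t) = 2 cos t, because cexpi t * cexpi (- t) = 1. *)
Lemma char_poly_floquet2 (a v : 'rV[R]_2) theta :
  char_poly (floquet a v theta) = map_poly (real_complex R)
    (discriminant2 a v - (2 * a 0 0 * a 0 1 * cos (2 * pi * theta))%:P).
Proof.
rewrite /char_poly det2 !mxE /=.
rewrite ?(mulr1n, mulr0n, addr0, add0r).
rewrite /discriminant2 !(rmorphB, rmorphM, rmorphD, rmorphXn) /= !map_polyX !map_polyC /=.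
have eM := polyC_cexpiMN (2 * pi * theta).
have eD := polyC_cexpiDN (2 * pi * theta).
move: eM eD; set E := (cexpi (2 * pi * theta))%:P.
set F := (cexpi (- (2 * pi * theta)))%:P => eM eD.
set a0 := ((a 0 0)%:C)%:P; set a1 := ((a 0 1)%:C)%:P.
set x0 := 'X - _%:P; set x1 := 'X - _%:P.
transitivity (x0 * x1 - (a0 * a0 + E * F * (a1 * a1)) - (E + F) * a0 * a1).
  by ring.
by rewrite eM eD; ring.
Qed.

Lemma char_poly_floquet3 (a v : 'rV[R]_3) theta :
  char_poly (floquet a v theta) = map_poly (real_complex R)
    (discriminant3 a v - (2 * (a 0 0 * a 0 1 * a 0 2) * cos (2 * pi * theta))%:P).
Proof.
rewrite /char_poly det3 !mxE /=.
rewrite ?(mulr1n, mulr0n, addr0, add0r).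
rewrite /discriminant3 !(rmorphB, rmorphM, rmorphD, rmorphXn) /= !map_polyX !map_polyC /=.
have eM := polyC_cexpiMN (2 * pi * theta).
have eD := polyC_cexpiDN (2 * pi * theta).
move: eM eD; set E := (cexpi (2 * pi * theta))%:P.
set F := (cexpi (- (2 * pi * theta)))%:P => eM eD.
set a0 := ((a 0 0)%:C)%:P; set a1 := ((a 0 1)%:C)%:P; set a2 := ((a 0 2)%:C)%:P.
set x0 := 'X - _%:P; set x1 := 'X - _%:P; set x2 := 'X - _%:P.
transitivity (x0 * x1 * x2 - a0 * a0 * x2 - a1 * a1 * x0 - E * F * (a2 * a2) * x1
  - (E + F) * (a0 * a1 * a2)).
  by ring.
by rewrite eM eD; ring.
Qed.

End FloquetSpectrum.

(** * Hermitian matrices with a double eigenvalue zero *)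

Section DoubleZero.
Context {R : realFieldType}.

(** The matrix has diagonal d0, d1 and an off-diagonal entry of squared modulus
    a0^2 + a1^2 + 2 a0 a1 c. Vanishing trace and determinant say that d0^2 plus
    this squared modulus is 0. *)
Lemma hermitian2_double0 (d0 d1 a0 a1 c : R) :
  0 < a0 -> 0 < a1 -> -1 <= c ->
  d0 * d1 - (a0 ^+ 2 + a1 ^+ 2) = 2 * a0 * a1 * c -> d0 + d1 = 0 ->
  d0 = d1 /\ a0 = a1.
Proof.
move=> a0_gt0 a1_gt0 c1 det0 tr0.
have d1E : d1 = - d0 by lra.
have p0 : 0 <= a0 * a1 * (1 + c) by rewrite !mulr_ge0 ?(ltW a0_gt0) ?(ltW a1_gt0)//; lra.
have sum0 : d0 ^+ 2 + (a0 - a1) ^+ 2 + 2 * (a0 * a1 * (1 + c)) = 0.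
  by move: det0; rewrite d1E => det0; lra.
have d00 : d0 ^+ 2 = 0 by have := sqr_ge0 d0; have := sqr_ge0 (a0 - a1); lra.
have a01 : (a0 - a1) ^+ 2 = 0 by have := sqr_ge0 d0; have := sqr_ge0 (a0 - a1); lra.
by move/eqP: d00 a01; rewrite sqrf_eq0 => /eqP + /eqP; rewrite sqrf_eq0 => ? /eqP; lra.
Qed.

(** The matrix H has diagonal d0, d1, d2 and off-diagonal entries of moduli
    a0, a1, a2; the real part of their product around the triangle is - a0 a1 a2 c,
    so that the determinant is the difference of the two sides of the equation.
    A double eigenvalue 0 means that the determinant and the sum of the principal
    2-minors vanish. These minors are the diagonal of the adjugate of H, a Hermitian
    matrix, which thus has trace 0. The 2-minors of the adjugate are multiples of
    the determinant of H, hence 0, so that any two of its diagonal entries have as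
    product the square of a modulus, which is nonnegative. Real numbers with sum 0
    and nonnegative pairwise products are all 0. *)
Lemma hermitian3_double0 (d0 d1 d2 a0 a1 a2 c : R) : c ^+ 2 <= 1 ->
  d0 * d1 * d2 - a0 ^+ 2 * d2 - a1 ^+ 2 * d0 - a2 ^+ 2 * d1
    = 2 * (a0 * a1 * a2) * c ->
  d0 * d1 + d0 * d2 + d1 * d2 = a0 ^+ 2 + a1 ^+ 2 + a2 ^+ 2 ->
  [/\ d0 * d1 = a0 ^+ 2, d1 * d2 = a1 ^+ 2 & d0 * d2 = a2 ^+ 2].
Proof.
move=> c1 det0 sum_minors.
have minor_ge0 (e0 e1 e2 b0 b1 b2 : R) :
    e0 * e1 * e2 - b0 ^+ 2 * e2 - b1 ^+ 2 * e0 - b2 ^+ 2 * e1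
      = 2 * (b0 * b1 * b2) * c ->
    0 <= (e1 * e2 - b1 ^+ 2) * (e0 * e2 - b2 ^+ 2).
  move=> D0.
  have -> : (e1 * e2 - b1 ^+ 2) * (e0 * e2 - b2 ^+ 2) =
      e2 * (e0 * e1 * e2 - b0 ^+ 2 * e2 - b1 ^+ 2 * e0 - b2 ^+ 2 * e1)
      + (b0 * e2) ^+ 2 + (b1 * b2) ^+ 2 by ring.
  rewrite D0.
  (* A squared modulus: the off-diagonal entry of the adjugate is, up to a phase,
     b0 e2 + b1 b2 u with u of modulus 1 and real part c. *)
  have -> : e2 * (2 * (b0 * b1 * b2) * c) + (b0 * e2) ^+ 2 + (b1 * b2) ^+ 2 =
      (b0 * e2 + b1 * b2 * c) ^+ 2 + (b1 * b2) ^+ 2 * (1 - c ^+ 2) by ring.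
  by rewrite addr_ge0 ?sqr_ge0// mulr_ge0 ?sqr_ge0 ?subr_ge0.
have h01 := minor_ge0 d0 d1 d2 a0 a1 a2 det0.
have h12 : 0 <= (d0 * d2 - a2 ^+ 2) * (d0 * d1 - a0 ^+ 2).
  have := minor_ge0 d1 d2 d0 a1 a2 a0; rewrite [d2 * d0]mulrC [d1 * d0]mulrC.
  by apply; lra.
have h20 : 0 <= (d0 * d1 - a0 ^+ 2) * (d1 * d2 - a1 ^+ 2).
  have := minor_ge0 d2 d0 d1 a2 a0 a1; rewrite [d2 * d1]mulrC.
  by apply; lra.
have tr0 : (d1 * d2 - a1 ^+ 2) + (d0 * d2 - a2 ^+ 2) + (d0 * d1 - a0 ^+ 2) = 0 by lra.
move: h01 h12 h20 tr0.
set x := _ - a1 ^+ 2; set y := _ - a2 ^+ 2; set z := _ - a0 ^+ 2 => xy yz zx xyz.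
have : x ^+ 2 + y ^+ 2 + z ^+ 2 + 2 * (x * y + y * z + z * x) = 0.
  by transitivity ((x + y + z) ^+ 2); [ring|rewrite xyz expr0n].
have := sqr_ge0 x; have := sqr_ge0 y; have := sqr_ge0 z => z2 y2 x2 sum0.
have x0 : x ^+ 2 = 0 by lra.
have y0 : y ^+ 2 = 0 by lra.
have z0 : z ^+ 2 = 0 by lra.
by split; apply/eqP; rewrite -subr_eq0 -sqrf_eq0; apply/eqP.
Qed.

End DoubleZero.

(** * Cyclic shifts *)

Section GapCount.
Context {R : realType}.

Lemma constant_reducible p (v : 'rV[R]_p) : (1 < p)%N ->
  (forall j k, v 0 j = v 0 k) -> ~ irreducible_vec v.
Proof.
move=> p1 vc vi.
suff : Ordinal (ltnW p1) = Ordinal p1 by [].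
apply: vi => /=; apply/rowP => j; rewrite mxE; exact: vc.
Qed.

Definition ramp p : 'rV[R]_p := \row_(j < p) j.+1%:R.

Lemma positive_ramp p : positive_vec (ramp p).
Proof. by move=> j; rewrite mxE ltr0n. Qed.

Lemma iter_cycE p (v : 'rV[R]_p) k j : iter k cyc v 0 j = v 0 (iter k (@ordS p) j).
Proof. by elim: k j => //= k IH j; rewrite mxE IH -iterSr. Qed.

Lemma val_iter_ordS p k (j : 'I_p) : iter k (@ordS p) j = ((j + k) %% p)%N :> nat.
Proof.
elim: k => [|k IH] /=; first by rewrite addn0 modn_small.
by rewrite IH -addn1 modnDml addn1 addnS.
Qed.

(** The shifts of the ramp are told apart by their first entries 1, 2, ..., p. *)
Lemma irreducible_ramp p : irreducible_vec (ramp p).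
Proof.
case: p => [|p] j k; first by case: j.
move/rowP/(_ 0); rewrite !iter_cycE !mxE => /eqP; rewrite eqr_nat eqSS.
by rewrite !val_iter_ordS !add0n !modn_small// => /eqP/val_inj.
Qed.

(** * Closed gaps in orders 2 and 3 *)

Lemma closed_gap2 (a v : 'rV[R]_2) l : positive_vec a -> closed_gap a v l ->
  l - v 0 0 = l - v 0 1 /\ a 0 0 = a 0 1.
Proof.
move=> a_gt0 gap.
have A0 : 2 * a 0 0 * a 0 1 != 0 by rewrite !mulf_neq0 ?gt_eqF.
have [theta [q0 dq0]] := closed_gap_double_root A0 (char_poly_floquet2 a v) gap.
apply: (@hermitian2_double0 _ _ _ _ _ (cos (2 * pi * theta))) => //.
- exact: cos_geN1.
- by move: q0; rewrite /discriminant2 !(hornerXsubC, hornerM, hornerD, hornerN, hornerC).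
move: dq0; rewrite /discriminant2 derivB derivM !derivXsubC derivC.
by rewrite !(hornerXsubC, hornerM, hornerD, hornerN, hornerC) => dq0; lra.
Qed.

Lemma closed_gap3 (a v : 'rV[R]_3) l : positive_vec a -> closed_gap a v l ->
  [/\ (l - v 0 0) * (l - v 0 1) = a 0 0 ^+ 2,
      (l - v 0 1) * (l - v 0 2) = a 0 1 ^+ 2
    & (l - v 0 0) * (l - v 0 2) = a 0 2 ^+ 2].
Proof.
move=> a_gt0 gap.
have A0 : 2 * (a 0 0 * a 0 1 * a 0 2) != 0 by rewrite !mulf_neq0 ?gt_eqF.
have [theta [q0 dq0]] := closed_gap_double_root A0 (char_poly_floquet3 a v) gap.
apply: (@hermitian3_double0 _ _ _ _ _ _ _ (cos (2 * pi * theta))).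
- by have := cos2Dsin2 (2 * pi * theta); have := sqr_ge0 (sin (2 * pi * theta)); lra.
- by move: q0; rewrite /discriminant3 !(hornerXsubC, hornerM, hornerD, hornerN, hornerC).
move: dq0; rewrite /discriminant3 !derivB !derivM !derivXsubC !derivC.
by rewrite !(hornerXsubC, hornerM, hornerD, hornerN, hornerC) => dq0; lra.
Qed.

Lemma constant_rV2 (v : 'rV[R]_2) : v 0 0 = v 0 1 -> forall j k, v 0 j = v 0 k.
Proof.
move=> v01; suff vE j : v 0 j = v 0 0 by move=> j k; rewrite !vE.
case: j => -[|[|//]] jp; first by congr (v 0 _); apply/val_inj.
by rewrite v01; congr (v 0 _); apply/val_inj.
Qed.

Lemma constant_rV3 (v : 'rV[R]_3) : v 0 0 = v 0 1 -> v 0 0 = v 0 2 ->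
  forall j k, v 0 j = v 0 k.
Proof.
move=> v01 v02; suff vE j : v 0 j = v 0 0 by move=> j k; rewrite !vE.
case: j => -[|[|[|//]]] jp; first by congr (v 0 _); apply/val_inj.
  by rewrite v01; congr (v 0 _); apply/val_inj.
by rewrite v02; congr (v 0 _); apply/val_inj.
Qed.

(** * Vanishing of the number of closed gaps *)

Lemma num_closed_gaps0 p (a v : 'rV[R]_p) :
  (forall l, ~ closed_gap a v l) -> num_closed_gaps a v = 0%N.
Proof.
move=> ng; rewrite /num_closed_gaps.
have -> : [set l | closed_gap a v l] = set0 by rewrite -subset0 => l /ng.
by rewrite fset_set0 cardfs0.
Qed.

Lemma gDSO2_eq0 (v : 'rV[R]_2) : irreducible_vec v -> gDSO v = 0%N.
Proof.
move=> vi; apply: num_closed_gaps0 => l /closed_gap2[].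
  by move=> j; rewrite mxE ltr01.
by move/addrI/oppr_inj => v01 _; apply: (constant_reducible _ (constant_rV2 v01) vi).
Qed.

Lemma gODJM2_eq0 (a : 'rV[R]_2) : positive_vec a -> irreducible_vec a -> gODJM a = 0%N.
Proof.
move=> a_gt0 ai; apply: num_closed_gaps0 => l /(closed_gap2 a_gt0)[_ a01].
exact: (constant_reducible _ (constant_rV2 a01) ai).
Qed.

Lemma gDSO3_eq0 (v : 'rV[R]_3) : irreducible_vec v -> gDSO v = 0%N.
Proof.
move=> vi; apply: num_closed_gaps0 => l /closed_gap3[].
  by move=> j; rewrite mxE ltr01.
rewrite !mxE !expr1n => d01 d12 d02.
have d0 : l - v 0 0 != 0.
  by apply/eqP => d0; move: d01; rewrite d0 mul0r => /esym/eqP; rewrite oner_eq0.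
have d2 : l - v 0 2 != 0.
  by apply/eqP => d2; move: d02; rewrite d2 mulr0 => /esym/eqP; rewrite oner_eq0.
have v12 : v 0 1 = v 0 2.
  by apply/oppr_inj/(addrI l)/(mulfI d0); rewrite d01 d02.
have v01 : v 0 0 = v 0 1.
  by apply/oppr_inj/(addrI l)/(mulIf d2); rewrite d12 d02.
by apply: (constant_reducible _ (constant_rV3 v01 _) vi); rewrite // v01.
Qed.

Lemma gODJM3_eq0 (a : 'rV[R]_3) : positive_vec a -> irreducible_vec a -> gODJM a = 0%N.
Proof.
move=> a_gt0 ai; apply: num_closed_gaps0 => l /(closed_gap3 a_gt0).
rewrite !mxE => -[a0 a1 a2].
have aI j k : a 0 j ^+ 2 = a 0 k ^+ 2 -> a 0 j = a 0 k.
  by move/eqP; rewrite eqrXn2 ?ltW// => /eqP.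
apply: (constant_reducible _ (constant_rV3 _ _) ai) => //.
  by apply: aI; rewrite -a0 -a1.
by apply: aI; rewrite -a0 -a2.
Qed.

End GapCount.

Theorem theorem1p6 (R : realType) :
  [/\ gDSO_max_is R 2 0, gDSO_max_is R 3 0, gODJM_max_is R 2 0 & gODJM_max_is R 3 0]
  /\
  [/\ forall v : 'rV[R]_2, irreducible_vec v -> gDSO v = 0%N,
      forall v : 'rV[R]_3, irreducible_vec v -> gDSO v = 0%N,
      forall a : 'rV[R]_2, positive_vec a -> irreducible_vec a -> gODJM a = 0%N
    & forall a : 'rV[R]_3, positive_vec a -> irreducible_vec a -> gODJM a = 0%N].
Proof.
have max0 (T : Type) (P : set T) (g : T -> nat) x : P x -> (forall y, P y -> g y = 0%N) ->
    is_max [set g y | y in P] 0%N.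
  by move=> Px g0; split=> [|_ [y Py <-]]; [exists x => //|]; rewrite g0.
split; split.
- by apply: (max0 _ _ _ (ramp 2)); [exact: irreducible_ramp|exact: gDSO2_eq0].
- by apply: (max0 _ _ _ (ramp 3)); [exact: irreducible_ramp|exact: gDSO3_eq0].
- apply: (max0 _ _ _ (ramp 2)) => [|a [a_gt0 ai]]; last exact: gODJM2_eq0.
  by split; [exact: positive_ramp|exact: irreducible_ramp].
- apply: (max0 _ _ _ (ramp 3)) => [|a [a_gt0 ai]]; last exact: gODJM3_eq0.
  by split; [exact: positive_ramp|exact: irreducible_ramp].
- exact: gDSO2_eq0.
- exact: gDSO3_eq0.
- exact: gODJM2_eq0.
- exact: gODJM3_eq0.
Qed.
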